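(* Let $a$ be a binary sequence of length $n$ and let $1\leq k<n$. Put $\delta_j=a_ja_{n+1-j}$ for $1\le j\le n$. (i) If $k$ is even, then $$C_{n-k}=\sum_{j=1}^{\frac{k}{2}}a_{j}a_{k+1-j}(\delta_{j}+\delta_{k+1-j}).$$ (ii) If $k$ is odd, then $$C_{n-k}=\delta_{\frac{k+1}{2}}+\sum_{j=1}^{\frac{k-1}{2}}a_{j}a_{k+1-j}(\delta_{j}+\delta_{k+1-j}).$$
   Context: For an integer $n>1$, a binary sequence of length $n$ is an element $a=(a_1,\dots,a_n)$ of $\{-1,1\}^n$. For $k=0,1,\dots,n-1$ its $k$th aperiodic autocorrelation is $C_k=C_k(a)=\sum_{j=1}^{n-k}a_ja_{j+k}$. Empty sums are $0$. *)

(* Defs.v *)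
From mathcomp Require Import all_boot all_order all_algebra.

Set Implicit Arguments.
Unset Strict Implicit.
Unset Printing Implicit Defensive.

Import Order.TTheory GRing.Theory Num.Theory.
Local Open Scope ring_scope.

Definition binary_seq (n : nat) (a : n.-tuple int) : bool :=
  all (fun x => (x == -1) || (x == 1)) a.

(* Indices are 1-based: [entry a j] is a_j for 1 <= j <= n.  The values at
   j = 0 (equal to a_1) and j > n (equal to 0) are junk. *)
Definition entry (n : nat) (a : n.-tuple int) (j : nat) : int :=
  nth 0 a j.-1.

Definition autocorr (n : nat) (a : n.-tuple int) (k : nat) : int :=
  \sum_(1 <= j < (n - k).+1) entry a j * entry a (j + k).

Definition delta (n : nat) (a : n.-tuple int) (j : nat) : int :=
  entry a j * entry a (n + 1 - j).

(* Main.v *)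
Require Import Defs.
From mathcomp Require Import all_boot all_order all_algebra.
From mathcomp Require Import zify ring.

(** The autocorrelation [C_(n-k)] is the sum of the [k] products
[a_j a_(j+n-k)].  Since [a_(k+1-j)] squares to 1, such a product equals
[a_j a_(k+1-j) delta_(k+1-j)] ([entry_prod_delta]), where the factor
[a_j a_(k+1-j)] is invariant under the reflection [j |-> k+1-j].  Pairing the
indices exchanged by this reflection ([sum_reflect]) therefore produces the
sums [delta_j + delta_(k+1-j)]; when [k] is odd, the fixed index
[(k+1)/2] remains, and there [a_j a_(j+n-k)] is [delta_j] itself. *)

Set Implicit Arguments.
Unset Strict Implicit.
Unset Printing Implicit Defensive.

Import Order.TTheory GRing.Theory Num.Theory.
Local Open Scope ring_scope.

(** The index left over when [k] is odd is the fixed point of the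
reflection [j |-> k+1-j]. *)
Lemma sum_reflect (V : nmodType) (F : nat -> V) (k : nat) :
  \sum_(1 <= j < k.+1) F j =
    (if odd k then F (k + 1)./2 else 0)
    + \sum_(1 <= j < k./2.+1) (F j + F (k + 1 - j)%N).
Proof.
have kE := odd_double_half k; set h := k./2 in kE *.
have upper : \sum_((k - h).+1 <= j < k.+1) F j =
             \sum_(1 <= j < h.+1) F (k + 1 - j)%N.
  rewrite [RHS]big_nat_rev -(add1n (k - h)) big_addn.
  have -> : (k.+1 - (k - h) = h.+1)%N by lia.
  by apply: eq_big_nat => j /andP[j1 jh]; congr F; lia.
have middle : \sum_(h.+1 <= j < (k - h).+1) F j =
              if odd k then F (k + 1)./2 else 0.
  case: (odd k) kE => kE.
    have -> : ((k - h).+1 = h.+2)%N by lia.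
    by rewrite big_nat1; congr F; lia.
  by rewrite big_geq //; lia.
rewrite (big_cat_nat (n := h.+1)) /=; [|lia|lia].
rewrite (big_cat_nat (m := h.+1) (n := (k - h).+1)) /=; [|lia|lia].
by rewrite upper middle big_split /= addrCA.
Qed.

Lemma entry_sqr (n : nat) (a : n.-tuple int) (j : nat) :
  binary_seq a -> (0 < j <= n)%N -> entry a j * entry a j = 1.
Proof.
move=> /allP ha /andP[j0 jn].
have /ha : entry a j \in a by rewrite mem_nth // size_tuple prednK.
by case/orP => /eqP ->.
Qed.

Lemma entry_prod_delta (n : nat) (a : n.-tuple int) (k j : nat) :
  binary_seq a -> (k <= n)%N -> (0 < j <= k)%N ->
  entry a j * entry a (j + (n - k)) =
    entry a j * entry a (k + 1 - j) * delta a (k + 1 - j).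
Proof.
move=> ha kn /andP[j0 jk]; rewrite /delta.
have -> : (n + 1 - (k + 1 - j) = j + (n - k))%N by lia.
by rewrite -mulrA [X in _ = _ * X]mulrA entry_sqr ?mul1r //; lia.
Qed.

Lemma autocorr_reflect (n : nat) (a : n.-tuple int) (k : nat) :
  binary_seq a -> (k <= n)%N ->
  autocorr a (n - k) =
    (if odd k then delta a (k + 1)./2 else 0) +
    \sum_(1 <= j < k./2.+1)
      entry a j * entry a (k + 1 - j) * (delta a j + delta a (k + 1 - j)).
Proof.
move=> ha kn; rewrite /autocorr subKn // sum_reflect; congr (_ + _).
  case: ifP => // k_odd; rewrite /delta; congr (_ * entry a _).
  by have := odd_double_half k; rewrite k_odd; lia.
apply: eq_big_nat => j /andP[j0 jh].
have jk : (j <= k)%N by lia.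
rewrite !entry_prod_delta //; [|lia|lia].
have -> : (k + 1 - (k + 1 - j) = j)%N by lia.
by ring.
Qed.

Theorem lemma5 (n : nat) (a : n.-tuple int) (k : nat)
    (hn : (1 < n)%N) (ha : binary_seq a) (hk1 : (1 <= k)%N) (hkn : (k < n)%N) :
  (~~ odd k ->
     autocorr a (n - k) =
       \sum_(1 <= j < k./2.+1)
         entry a j * entry a (k + 1 - j) * (delta a j + delta a (k + 1 - j)))
  /\
  (odd k ->
     autocorr a (n - k) =
       delta a (k + 1)./2 +
       \sum_(1 <= j < (k - 1)./2.+1)
         entry a j * entry a (k + 1 - j) * (delta a j + delta a (k + 1 - j))).
Proof.
rewrite autocorr_reflect //; last exact: ltnW.
split=> [/negbTE -> | k_odd]; first by rewrite add0r.
have -> // : (k - 1)./2 = k./2 by lia.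
by rewrite k_odd.
Qed.
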